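(* Let $X$ be an abelian Polish group that is not locally compact. Then there is a closed meager set $F\subseteq X$ which is not Haar meager.
   Context: An abelian Polish group is an abelian topological group (written additively) whose topology is separable and completely metrizable. For $B\subseteq X$ and $x\in X$, $B+x=\{b+x : b\in B\}$. A subset of a topological space is meager in that space if it is a countable union of nowhere dense subsets of that space. A set $A\subseteq X$ is Haar meager if there exist a Borel set $B\subseteq X$ with $A\subseteq B$, a nonempty compact metric space $K$, and a continuous function $f:K\to X$ such that $f^{-1}(B+x)$ is meager in $K$ for every $x\in X$. *)

(* Defs.v *)
From HB Require Import structures.
From mathcomp Require Import all_boot all_order all_algebra.
From mathcomp Require Import all_classical reals topology tvs measurable_structure.

Set Implicit Arguments.
Unset Strict Implicit.
Unset Printing Implicit Defensive.

Import Order.TTheory GRing.Theory Num.Theory.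

Local Open Scope classical_set_scope.
Local Open Scope ring_scope.

Definition separable (T : topologicalType) : Prop :=
  exists2 D : set T, countable D & dense D.

(* [d] is not tied to any metric or uniform structure carried by [T]: only the
   topology of [T] is involved.  Nonnegativity of [d] follows from the first
   three conditions. *)
Definition complete_compatible_metric (R : realType) (T : topologicalType)
    (d : T -> T -> R) : Prop :=
  [/\ forall x y, d x y = 0 <-> x = y,
      forall x y, d x y = d y x,
      forall x y z, d x z <= d x y + d y z,
      forall (x : T) (U : set T),
        nbhs x U <-> exists2 e : R, 0 < e & [set y | d x y < e] `<=` U
    & forall u : nat -> T,
        (forall e : R, 0 < e -> exists N : nat, forall m n : nat,
            (N <= m)%N -> (N <= n)%N -> d (u m) (u n) < e) ->
        exists l : T, u n @[n --> \oo] --> l].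

Definition completely_metrizable (R : realType) (T : topologicalType) : Prop :=
  exists d : T -> T -> R, complete_compatible_metric d.

Definition polish (R : realType) (T : topologicalType) : Prop :=
  separable T /\ completely_metrizable R T.

Definition nowhere_dense (T : topologicalType) (A : set T) : Prop :=
  interior (closure A) = set0.

(* Finite unions are covered since [set0] is nowhere dense. *)
Definition meager (T : topologicalType) (A : set T) : Prop :=
  exists2 N : nat -> set T,
    (forall i, nowhere_dense (N i)) & A = \bigcup_i N i.

Definition borel (T : topologicalType) : set (set T) := <<s @open T >>.

(* Meagerness of the preimages is relative to the topology of [K]. *)
Definition haar_meager (R : realType) (X : topologicalZmodType) (A : set X)
    : Prop :=
  exists B : set X, [/\ borel B, A `<=` B
    & exists (K : metricType R) (f : K -> X),
      [/\ [set: K] !=set0, compact [set: K], continuous f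
        & forall x : X, meager (f @^-1` [set b + x | b in B])]].

(* Main.v *)
Require Import Defs.
From HB Require Import structures.
From mathcomp Require Import all_boot all_order all_algebra.
From mathcomp Require Import all_classical reals interval_inference topology.
From mathcomp Require Import num_normedtype tvs.
From mathcomp Require Import ring lra.

Set Implicit Arguments.
Unset Strict Implicit.
Unset Printing Implicit Defensive.

Import Order.TTheory GRing.Theory Num.Theory.

Local Open Scope classical_set_scope.
Local Open Scope ring_scope.

(** The set F is closed, contains a translate of every compact subset of X, and
    contains no nonempty open set.  Such an F is nowhere dense; and if B is a
    set containing F and f : K -> X is continuous on a compact K, then
    f(K) + x is included in F for some x, so that the preimage of B - x under f
    is all of K, which is not meager by the Baire category theorem
    (compact_nonmeager).

    The set F is an intersection of closed sets G_n, one for each member V_n of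
    a shrinking sequence of neighborhoods of 0.  Each G_n catches every compact
    set at scale V_n: an arbitrary compact C can be moved into G_n by a
    translation from V_n, with room V'_n to spare; and G_n contains no translate
    of V_n (catching_set_at_scale).  To build G_n, list finite sets
    S_0, S_1, ... such that every compact set is covered, up to any prescribed
    error, by one of them, and let G_n be the closure of the union of the sets
    S_k + g_k + U, with U small and g_k in V_n.  Since V_n is not totally
    bounded, the g_k can be chosen one after the other so that the sets
    S_k + g_k are uniformly far from each other.  A translate of a small
    neighborhood of 0 then meets only one of the sets S_k + g_k + U, that is,
    finitely many translates of U, which do not cover it when U is small enough.
    Given a compact C, correct it successively by g_0 in V_0, g_1 in V_1, and so
    on, each correction being small enough not to spoil the earlier ones; the
    sum of the corrections translates C into F (compact_catcher).

    Both the convergence of that sum and the failure of total boundedness of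
    neighborhoods of 0 in a group that is not locally compact require that
    sequences that are Cauchy for the group structure converge, whereas the
    complete metric at hand need not be translation invariant.  This is Klee's
    theorem, completely_metrizable_seq_complete. *)

(** * Neighborhoods in a topological group *)

Lemma addr_continuous (X : topologicalZmodType) (t : X) :
  continuous (fun y : X => y + t).
Proof.
move=> y; apply: (@continuous_comp _ _ _ (fun y : X => (y, t))
  (fun z : X * X => z.1 + z.2)); last exact: add_continuous.
by apply: cvg_pair; [exact: cvg_id | exact: cvg_cst].
Qed.

Lemma nbhs_translate (X : topologicalZmodType) (x : X) (A : set X) :
  nbhs x A <-> nbhs (0 : X) [set y | A (x + y)].
Proof.
split=> [xA|A0].
  have := @addr_continuous X x 0 A; rewrite add0r => /(_ xA) h.
  by apply: (@filterS _ (nbhs (0 : X)) _ _ _ _ h) => y /=; rewrite addrC.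
have := @addr_continuous X (- x) x [set y | A (x + y)].
rewrite subrr => /(_ A0) h.
by apply: (@filterS _ (nbhs x) _ _ _ _ h) => y /=; rewrite subrKC.
Qed.

(** Continuity of addition at 0, the group counterpart of halving a radius. *)
Lemma nbhs0_split (X : topologicalZmodType) (V : set X) : nbhs (0 : X) V ->
  exists W, [/\ nbhs (0 : X) W, forall x, W x -> W (- x), W `<=` V
    & forall x y, W x -> W y -> V (x + y)].
Proof.
move=> V0; have := @add_continuous X (0, 0) V; rewrite /= addr0.
move=> /(_ V0)[[A B] /= [A0 B0] ABV].
pose C := A `&` B; pose W := C `&` -%R @^-1` C.
have C0 : nbhs (0 : X) C by exact: filterI.
have W0 : nbhs (0 : X) W.
  apply: filterI => //.
  by have := @opp_continuous X 0 C; rewrite oppr0; exact.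
have WV x y : W x -> W y -> V (x + y).
  by move=> [[Ax _] _] [[_ By] _]; exact: (ABV (x, y)).
exists W; split => //.
- by move=> x [Cx CNx]; split => //=; rewrite opprK.
- by move=> x Wx; rewrite -[x]addr0; apply: WV => //; exact: nbhs_singleton.
Qed.

Lemma closure_near (X : topologicalZmodType) (A W : set X) (y : X) :
  nbhs (0 : X) W -> (forall x, W x -> W (- x)) -> closure A y ->
  exists2 a, A a & W (y - a).
Proof.
move=> W0 WN /(_ [set z | W (y - z)])[].
  apply/nbhs_translate; apply: filterS W0 => z Wz /=.
  by rewrite opprD addNKr; exact: WN.
by move=> a [Aa Wa]; exists a.
Qed.

Lemma cvg_sub_nbhs0 (X : topologicalZmodType) (x : nat -> X) (l : X) :
  (forall U, nbhs (0 : X) U -> exists N, forall n, (N <= n)%N -> U (x n - l)) ->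
  x n @[n --> \oo] --> l.
Proof.
move=> h U /nbhs_translate/h[N hN]; exists N => //= n /= Nn.
by have := hN n Nn; rewrite /= subrKC.
Qed.

(** * Completeness *)

Lemma summable_cauchy (R : realType) (T : topologicalType) (d : T -> T -> R)
    (u : nat -> T) : complete_compatible_metric d ->
  (forall n, d (u n) (u n.+1) < (1 / 2) ^+ n) ->
  exists l : T, u n @[n --> \oo] --> l.
Proof.
move=> [d0 dC dT _ cpl] du; apply: cpl => e e0.
have duD n p : d (u n) (u (n + p)%N) <= (1/2) ^+ n * (2 - 2 * (1 / 2) ^+ p).
  elim: p => [|p IH].
    by rewrite addn0 expr0 mulr1 subrr mulr0 (d0 _ _).2.
  apply: (le_trans (dT _ (u (n + p)%N) _)); rewrite addnS.
  have := du (n + p)%N; move/ltW => /(lerD IH) /le_trans; apply.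
  rewrite exprD exprS; set a := _ ^+ n; set b := _ ^+ p.
  by rewrite le_eqVlt; apply/orP; left; apply/eqP; field.
have [N hN] : exists N, (1/2) ^+ N < e / 4.
  have e40 : 0 < e / 4 by rewrite divr_gt0.
  have [N _ /(_ N (leqnn N))] := near_infty_natSinv_expn_lt (PosNum e40).
  by rewrite /= => h; exists N; rewrite expr_div_n expr1n.
have near p : d (u N) (u (N + p)%N) < e / 2.
  apply: (le_lt_trans (duD N p)).
  have : 0 <= (1/2 : R) ^+ p by apply: exprn_ge0; lra.
  have : 0 <= (1/2 : R) ^+ N by apply: exprn_ge0; lra.
  by nra.
exists N => m n Nm Nn; apply: (le_lt_trans (dT _ (u N) _)).
rewrite (dC (u m)); have := near (m - N)%N; have := near (n - N)%N.
by rewrite !subnKC //; lra.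
Qed.

(** Cauchy is meant here for the uniform structure of the group, which only
    depends on the neighborhoods of 0. *)
Definition seq_complete (X : topologicalZmodType) : Prop :=
  forall x : nat -> X,
    (forall U, nbhs (0 : X) U -> exists N : nat, forall m n : nat,
       (N <= m)%N -> (N <= n)%N -> U (x m - x n)) ->
    exists l : X, x n @[n --> \oo] --> l.

(** Let d be the complete metric and x be Cauchy for the group.  Its limit is
    sought as a difference al - ga, where al and ga are limits of two sequences
    a_n and c_n = a_n - x_(k_n) that are Cauchy for d.  The sequences are built
    in zigzag: a_(n+1) = c_n + x_m and c_(n+1) = a_(n+1) - x_k'.  The first move
    shifts a_n by x_m - x_(k_n), and k_n was chosen after a_n, so large that
    every such shift moves a_n by less than 2^-n; symmetrically the second move
    shifts c_n by x_m - x_k', and m was chosen after c_n.  This alternation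
    replaces the invariance that d lacks. *)
Lemma completely_metrizable_seq_complete (R : realType)
    (X : topologicalZmodType) : completely_metrizable R X -> seq_complete X.
Proof.
move=> [d cd] x xC; have [_ _ _ dN _] := cd.
have choose : forall z : nat * X * nat, exists k : nat, (z.2 <= k)%N /\
    forall j, (k <= j)%N ->
      d z.1.2 (z.1.2 + (x j - x k)) < (1 / 2) ^+ z.1.1 /\
      d z.1.2 (z.1.2 + (x k - x j)) < (1 / 2) ^+ z.1.1.
  move=> [[n a] b] /=.
  have : nbhs a [set y | d a y < (1/2) ^+ n].
    by apply/dN; exists ((1/2) ^+ n) => //; apply: exprn_gt0; lra.
  move=> /nbhs_translate/xC[N hN]; exists (maxn b N); rewrite leq_maxl.
  by split=> // j; rewrite geq_max => /andP[_ Nj]; split; apply: hN;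
     rewrite // leq_maxr.
have {choose}[kap' kapP'] := choice choose.
(* From the index kap n a b on, x varies so little that translating a by these
   variations moves it by less than (1 / 2) ^+ n. *)
pose kap n a b := kap' (n, a, b).
have kap_ge n a b : (b <= kap n a b)%N by have [] := kapP' (n, a, b).
have kap1 n a b j : (kap n a b <= j)%N ->
    d a (a + (x j - x (kap n a b))) < (1 / 2) ^+ n.
  by have [_ h] := kapP' (n, a, b) => /h[].
have kap2 n a b j : (kap n a b <= j)%N ->
    d a (a + (x (kap n a b) - x j)) < (1 / 2) ^+ n.
  by have [_ h] := kapP' (n, a, b) => /h[].
(* A state (a, k) stands for the pair of points a and c = a - x k; mid is the
   index m chosen after c. *)
pose mid n (s : X * nat) := kap n (s.1 - x s.2) s.2.
pose step n (s : X * nat) : X * nat :=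
  let a' := s.1 - x s.2 + x (mid n s) in (a', kap n.+1 a' (mid n s).+1).
pose fix st n : X * nat :=
  if n is p.+1 then step p (st p) else (0, kap 0%N 0 0%N).
have stK n : exists b, (st n).2 = kap n (st n).1 b.
  by case: n => [|n]; [exists 0%N | exists (mid n (st n)).+1].
have stE n : (st n.+1).1 = (st n).1 - x (st n).2 + x (mid n (st n)) by [].
have mid_ge n : ((st n).2 <= mid n (st n))%N by exact: kap_ge.
have mid_lt n : (mid n (st n) < (st n.+1).2)%N by exact: kap_ge.
have [al ha] : exists l : X, (st n).1 @[n --> \oo] --> l.
  apply: (summable_cauchy cd) => n; rewrite stE.
  have [b stb] := stK n; rewrite -addrA [- x _ + _]addrC stb.
  by apply: kap1; rewrite -stb.
have [ga hc] : exists l : X, ((st n).1 - x (st n).2) @[n --> \oo] --> l.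
  apply: (summable_cauchy cd) => n; rewrite stE -addrA.
  by apply: kap2; apply: ltnW; exact: mid_lt.
exists (al - ga); apply: cvg_sub_nbhs0 => U U0.
have [W [W0 WN WU WWU]] := nbhs0_split U0.
have [N hN] := xC _ W0.
have hx : x (st n).2 @[n --> \oo] --> al - ga.
  rewrite (_ : (fun n => x (st n).2)
    = (fun n => (st n).1 - ((st n).1 - x (st n).2))).
    exact: (@cvg_comp2 nat X X X \oo (nbhs al) (nbhs ga) (nbhs (al - ga)) _ _ _
      _ _ (fun y z => y - z) ha hc (@sub_continuous X (al, ga))).
  by apply/funext => n; rewrite subKr.
(* The indices k_n tend to infinity, so x shares its limit with x (k_n). *)
have st_ge n : (n <= (st n).2)%N.
  by elim: n => [//|n IH]; apply: leq_ltn_trans (mid_lt n);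
     exact: leq_trans (mid_ge n).
have /hx[M _ hM] : nbhs (al - ga) [set y | W (y - (al - ga))].
  by apply/nbhs_translate; apply: filterS W0 => y /=; rewrite addrC addKr.
exists N => n Nn; pose p := maxn N M.
rewrite -[x n](subrK (x (st p).2)) -addrA; apply: WWU.
  by apply: hN => //; apply: leq_trans (st_ge p); rewrite leq_maxl.
by apply: (hM p); rewrite /= leq_maxr.
Qed.

(** * Total boundedness and compactness *)

Definition nbhs0_base (X : topologicalZmodType) (B : nat -> set X) : Prop :=
  (forall n, nbhs (0 : X) (B n)) /\
  forall U, nbhs (0 : X) U -> exists n, B n `<=` U.

Lemma completely_metrizable_nbhs0_base (R : realType)
    (X : topologicalZmodType) : completely_metrizable R X ->
  exists B : nat -> set X, nbhs0_base B.
Proof.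
move=> [d [_ _ _ dN _]].
exists (fun n => [set y | d 0 y < (1 / 2) ^+ n]); split=> [n|U].
  by apply/dN; exists ((1/2) ^+ n) => //; apply: exprn_gt0; lra.
move=> /dN[e e0 eU].
have [N _ /(_ N (leqnn N)) /= hN] := near_infty_natSinv_expn_lt (PosNum e0).
exists N => y /= yN; apply: eU => /=; apply: lt_trans hN.
by move: yN; rewrite expr_div_n expr1n.
Qed.

Definition translates (X : zmodType) (s : seq X) (W : set X) : set X :=
  [set y | exists2 t, t \in s & W (y - t)].

Definition totally_bounded (X : topologicalZmodType) (A : set X) : Prop :=
  forall W, nbhs (0 : X) W -> exists s : seq X, A `<=` translates s W.

Lemma totally_bounded_closure (X : topologicalZmodType) (A : set X) :
  totally_bounded A -> totally_bounded (closure A).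
Proof.
move=> tbA W /nbhs0_split[U [U0 UN _ UUW]].
have [s sA] := tbA _ U0; exists s => y.
move=> /(closure_near U0 UN)[a /sA[t ts Uat] Uya].
by exists t => //; rewrite -(subrK a y) -addrA; exact: UUW.
Qed.

Lemma totally_bounded_translate (X : topologicalZmodType) (A : set X) (x : X) :
  totally_bounded A -> totally_bounded [set y | A (y - x)].
Proof.
move=> tbA W /tbA[s sA]; exists [seq t + x | t <- s] => y /= /sA[t ts Wt].
exists (t + x); first exact: map_f.
by rewrite [t + x]addrC opprD addrA.
Qed.

Lemma ultra_translates (X : topologicalZmodType) (F : set_system X)
    (s : seq X) (W : set X) : UltraFilter F -> F (translates s W) ->
  exists t, F [set y | W (y - t)].
Proof.
move=> UF; elim: s => [|t s IH] Fs.
  have PF : ProperFilter F by exact: ultra_proper.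
  by case: (filter_not_empty F); apply: filterS Fs => y [].
have [Ft|FCt] := in_ultra_setVsetC [set y | W (y - t)] UF; first by exists t.
apply: IH; apply: filterS (filterI Fs FCt) => y [[u]].
rewrite inE => /orP[/eqP -> //|us Wu _]; by exists u.
Qed.

(** An ultrafilter on A contains, for each n, a translate of B n.  Points
    picked in finite intersections of these translates form a Cauchy sequence,
    whose limit is the limit of the ultrafilter. *)
Lemma totally_bounded_compact (X : topologicalZmodType) (B : nat -> set X)
    (A : set X) : seq_complete X -> nbhs0_base B ->
  closed A -> totally_bounded A -> compact A.
Proof.
move=> cX [B0 Bbase] clA tbA; rewrite compact_ultra => F UF FA.
have PF : ProperFilter F by exact: ultra_proper.
have small U : nbhs (0 : X) U -> exists t, F [set y | U (y - t)].
  by move=> /tbA[s sA]; exact: ultra_translates UF (filterS sA FA).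
have [t tP] := choice (fun n => small _ (B0 n)).
pose C n := A `&` [set y | forall i, (i <= n)%N -> B i (y - t i)].
have FC n : F (C n).
  apply: filterI => //; elim: n => [|n IH].
    by apply: filterS (tP 0%N) => y By i; rewrite leqn0 => /eqP ->.
  apply: filterS (filterI IH (tP n.+1)) => y [By BSy] i.
  by rewrite leq_eqVlt => /orP[/eqP -> //|]; exact: By.
have [x xC] := choice (fun n => filter_ex (FC n)).
have diff U : nbhs (0 : X) U -> exists N : nat, forall m, (N <= m)%N ->
    forall y, C N y -> U (x m - y).
  move=> /nbhs0_split[W [W0 WN _ WWU]]; have [N BW] := Bbase _ W0.
  exists N => m Nm y [_ /(_ N (leqnn N))/BW Wy].
  have [_ /(_ N Nm)/BW Wx] := xC m.
  rewrite -(subrK (t N) (x m)) -addrA; apply: WWU => //.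
  by rewrite -opprB; exact: WN.
have CN N m : (N <= m)%N -> C N (x m).
  by move=> Nm; have [Ax h] := xC m; split=> // i iN; apply: h;
     exact: leq_trans Nm.
have [l xl] : exists l : X, x n @[n --> \oo] --> l.
  apply: cX => U /diff[N hN]; exists N => m n Nm Nn.
  by apply: hN => //; exact: CN.
exists l; split.
  apply: clA => U /xl[N _ /(_ N (leqnn N)) /= Ux].
  by exists (x N); split=> //; have [] := xC N.
move=> U /nbhs_translate /nbhs0_split[W [W0 WN _ WWU]].
have [N hN] := diff _ W0.
have /xl[M _ hM] : nbhs l [set y | W (y - l)].
  by apply/nbhs_translate; apply: filterS W0 => y /=; rewrite addrC addKr.
apply: filterS (FC N) => y Cy; pose m := maxn N M.
have Wxy : W (x m - y) by apply: hN => //; rewrite leq_maxl.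
have Wxl : W (x m - l) by apply: (hM m); rewrite /= leq_maxr.
have := WWU _ _ (WN _ Wxy) Wxl.
by rewrite opprB addrA subrK /= subrKC.
Qed.

(** The closure of a totally bounded neighborhood of 0 is compact, and its
    translates are compact neighborhoods of all the other points. *)
Lemma not_locally_compact_not_totally_bounded (X : topologicalZmodType)
    (B : nat -> set X) : seq_complete X -> nbhs0_base B ->
  ~ locally_compact [set: X] ->
  forall V, nbhs (0 : X) V -> ~ totally_bounded V.
Proof.
move=> cX bB nlc V V0 tbV; apply: nlc => x _.
pose U := [set y | closure V (y - x)].
have clU : closed U.
  have /continuous_closedP := @addr_continuous X (- x).
  by apply; exact: closed_closure.
exists U; last first.
  split=> //; apply: (totally_bounded_compact cX bB) => //.
  exact/totally_bounded_translate/totally_bounded_closure.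
rewrite /within /=.
have : nbhs x U.
  apply/nbhs_translate; apply: filterS V0 => y Vy /=.
  by rewrite /U /= addrC addKr; exact: subset_closure.
by apply: filterS.
Qed.

(** * Finite nets for all compact sets *)

Lemma separable_dense_sequence (T : topologicalType) : separable T ->
  [set: T] !=set0 ->
  exists e : nat -> T,
    forall (x : T) (U : set T), nbhs x U -> exists n, U (e n).
Proof.
move=> [D cD dD] [x0 _].
have [y0 [_ Dy0]] := dD setT (ex_intro _ x0 I) openT.
move/pfcard_geP : cD => [D0|[e]]; first by rewrite D0 in Dy0.
exists e => x U /nbhs_interior xU.
have [||z [Uz Dz]] := dD U°; [|exact: open_interior|].
  by exists x; exact: nbhs_singleton.
have [n _ enz] := @surj _ _ _ _ e z Dz.
by exists n; rewrite enz; exact: interior_subset.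
Qed.

Definition universal_nets (X : topologicalZmodType) (S : nat -> seq X) : Prop :=
  forall C W, compact C -> nbhs (0 : X) W ->
    exists k, C `<=` translates (S k) W.

(** The initial segments of a dense sequence are such nets: they increase, so
    the property of lying close to the k-th one holds eventually in k, locally
    uniformly, and compactness makes it uniform. *)
Lemma separable_universal_nets (X : topologicalZmodType) : separable X ->
  exists S : nat -> seq X, universal_nets S.
Proof.
move=> sX; have [|e eP] := separable_dense_sequence sX; first by exists 0.
exists (fun k => [seq e i | i <- iota 0 k]) => C W.
move=> /compact_near_coveringP cC W0.
pose P k x := translates [seq e i | i <- iota 0 k] W x.
have [|N _ hN] := cC nat \oo P _; last by exists N; apply: hN => /=.
move=> x _; have [U [U0 UN _ UUW]] := nbhs0_split W0.
have [|n Un] := eP x [set y | U (x - y)].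
  apply/nbhs_translate; apply: filterS U0 => y Uy /=.
  by rewrite opprD addNKr; exact: UN.
exists ([set y | U (y - x)], [set k | (n < k)%N]) => /=.
  split; last by exists n.+1.
  by apply/nbhs_translate; apply: filterS U0 => y /=; rewrite addrC addKr.
move=> [y k] /= [Uy nk]; exists (e n).
  by apply: map_f; rewrite mem_iota add0n.
by rewrite -(subrK x y) -addrA; exact: UUW.
Qed.

(** * Closed sets catching all compact sets *)

Lemma not_totally_bounded_uncovered (X : topologicalZmodType) (V : set X) :
  ~ totally_bounded V ->
  exists2 W, nbhs (0 : X) W & forall s, ~ V `<=` translates s W.
Proof.
move=> /existsNP[W] /not_implyP[W0 nW]; exists W => // s sV.
by apply: nW; exists s.
Qed.

(** The requirement on g k excludes finitely many translates of W, namely those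
    of the points s + g j - t, and these do not cover V. *)
Lemma separated_translations (X : zmodType) (V W : set X) (S : nat -> seq X) :
  (forall s, ~ V `<=` translates s W) ->
  exists g : nat -> X, (forall k, V (g k)) /\
    forall j k s t, (j < k)%N -> s \in S j -> t \in S k ->
      ~ W (t + g k - (s + g j)).
Proof.
move=> VW.
have [pick pickP] : {f : seq X -> X & forall l, V (f l) /\
    forall z, z \in l -> ~ W (f l - z)}.
  apply: (@choice _ _
    (fun l x => V x /\ forall z, z \in l -> ~ W (x - z))) => l.
  have /existsNP[x /not_implyP[Vx lx]] := VW l.
  by exists x; split=> // z zl Wz; apply: lx; exists z.
(* used k lists the points s + g j with s in S j and j < k. *)
pose avoid (l : seq X) k := [seq f - t | f <- l, t <- S k].
pose fix used k : seq X := if k is j.+1 then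
  used j ++ [seq s + pick (avoid (used j) j) | s <- S j] else [::].
pose g k := pick (avoid (used k) k).
have used_mem j k s : (j < k)%N -> s \in S j -> s + g j \in used k.
  elim: k => // k IH; rewrite ltnS leq_eqVlt mem_cat => /orP[/eqP <-|jk] sj.
    by apply/orP; right; apply/mapP; exists s.
  by rewrite IH.
exists g; split=> [k|j k s t jk sj tk].
  by have [] := pickP (avoid (used k) k).
have [_ /(_ (s + g j - t))] := pickP (avoid (used k) k).
rewrite -/(g k) opprB addrCA addrA; apply.
by apply/allpairsP; exists (s + g j, t); split=> //=; exact: used_mem.
Qed.

(** The failure of total boundedness is used twice: V is not covered by finitely
    many translates of some W1, which gives room to spread the sets S k + g k
    apart; and V `&` B, where B is so small that B + B + B + B is included in
    W1, is not covered by finitely many translates of some W2, which makes the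
    pieces around the points of a single S k + g k too small to fill a translate
    of V `&` B. *)
Lemma catching_set_at_scale (X : topologicalZmodType) (S : nat -> seq X)
    (V : set X) :
  universal_nets S ->
  (forall V, nbhs (0 : X) V -> ~ totally_bounded V) ->
  nbhs (0 : X) V ->
  exists (V' G : set X), [/\ nbhs (0 : X) V', closed G,
    forall C : set X, compact C -> exists2 g, V g &
      forall c v, C c -> V' v -> G (c + g + v)
    & forall x : X, ~ forall v, V v -> G (x + v)].
Proof.
move=> netS ntb V0.
have [W1 W10 VW1] := not_totally_bounded_uncovered (ntb _ V0).
have [g [Vg sep]] := separated_translations S VW1.
have [A [A0 AN _ AAW1]] := nbhs0_split W10.
have [B [B0 BN BA BBA]] := nbhs0_split A0.
have VB0 : nbhs (0 : X) (V `&` B) by exact: filterI.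
have [W2 W20 VW2] := not_totally_bounded_uncovered (ntb _ VB0).
have [U [U0 UN _ UUW2]] := nbhs0_split (filterI W20 B0).
have [V' [V'0 _ _ V'V'U]] := nbhs0_split U0.
pose G := [set y | exists k, translates (S k) U (y - g k)].
have clG y : closure G y ->
    exists k s, s \in S k /\ (W2 `&` B) (y - (s + g k)).
  move=> /(closure_near U0 UN)[z [k [s sk Uz]] Uyz]; exists k, s; split=> //.
  have := UUW2 _ _ Uyz Uz.
  by rewrite !addrA subrK -addrA -opprD [g k + s]addrC.
exists V', (closure G); split=> //; first exact: closed_closure.
  move=> C cC; have [k Ck] := netS _ _ cC V'0.
  exists (g k) => // c v /Ck[s sk V's] V'v; apply: subset_closure.
  exists k, s => //; rewrite (_ : _ - s = c - s + v); first exact: V'V'U.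
  by rewrite [c + g k + v]addrAC addrK addrAC.
move=> x xV; have /clG[k0 [s0 [s0k0 [_ Bx]]]] := xV 0 (nbhs_singleton V0).
rewrite addr0 in Bx.
apply: (VW2 [seq s + g k0 - x | s <- S k0]) => v [Vv Bv].
have /clG[k [s [sk [W2v Bxv]]]] := xV v Vv.
(* The points x and x + v of G, caught by the nets k0 and k, bring these nets
   closer to each other than their separation allows, unless k = k0. *)
have far : W1 (s0 + g k0 - (s + g k)) /\ W1 (s + g k - (s0 + g k0)).
  have Ad : A (x + v - (s + g k) - v) by exact: BBA (BN _ Bv).
  split.
    rewrite (_ : _ - _ = x + v - (s + g k) - v - (x - (s0 + g k0))).
      by apply: AAW1 => //; exact/BA/BN.
    by rewrite [_ - v]addrAC addrK opprB [RHS]addrC addrA subrK.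
  rewrite (_ : _ - _ = - (x + v - (s + g k) - v) + (x - (s0 + g k0))).
    by apply: AAW1; [exact: AN | exact: BA].
  by rewrite [_ - v]addrAC addrK opprB addrA subrK.
have [kk0|kk0|kk0] := ltngtP k k0.
- by case: (sep k k0 s s0 kk0 sk s0k0 far.1).
- by case: (sep k0 k s0 s kk0 s0k0 sk far.2).
- subst k; exists (s + g k0 - x); first exact: map_f.
  by rewrite opprB addrCA addrA.
Qed.

(** Each V n.+1 is chosen so small that a finite sum of corrections, one from
    each of V n.+1, V n.+2, and so on, stays in V n and does not exceed the room
    V' n left by the set G n. *)
Lemma catching_set_sequence (X : topologicalZmodType) (S : nat -> seq X)
    (B : nat -> set X) :
  universal_nets S -> nbhs0_base B ->
  (forall V, nbhs (0 : X) V -> ~ totally_bounded V) ->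
  exists V V' G : nat -> set X, forall n,
    [/\ nbhs (0 : X) (V n) /\ V n `<=` B n,
      forall x y, V n.+1 x -> V n.+1 y -> V n (x + y) /\ V' n (x + y),
      closed (G n),
      forall C : set X, compact C -> exists2 g, V n g &
        forall c v, C c -> V' n v -> G n (c + g + v)
    & forall x : X, ~ forall v, V n v -> G n (x + v)].
Proof.
move=> netS [B0 _] ntb.
pose good n (P : set X) (t : set X * set X * set X) :=
  [/\ nbhs (0 : X) t.1.1 /\ t.1.1 `<=` B n,
      nbhs (0 : X) t.1.2 /\ forall x y, t.1.1 x -> t.1.1 y -> P (x + y),
      closed t.2,
      forall C : set X, compact C -> exists2 g, t.1.1 g &
        forall c v, C c -> t.1.2 v -> t.2 (c + g + v)
    & forall x : X, ~ forall v, t.1.1 v -> t.2 (x + v)].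
have [next nextP] : {f : nat * set X -> set X * set X * set X &
    forall z, nbhs (0 : X) z.2 -> good z.1 z.2 (f z)}.
  apply: (@choice _ _ (fun z t => nbhs (0 : X) z.2 -> good z.1 z.2 t)).
  move=> [n P] /=; have [P0|nP0] := pselect (nbhs (0 : X) P); last first.
    by exists (set0, set0, set0).
  have [W [W0 _ _ WWP]] := nbhs0_split P0.
  have V0 : nbhs (0 : X) (W `&` B n) by exact: filterI.
  have [V' [G [V'0 clG catch thin]]] := catching_set_at_scale netS ntb V0.
  exists (W `&` B n, V', G) => _; split=> //=.
  by split=> // x y [Wx _] [Wy _]; exact: WWP.
(* P n is the neighborhood that must contain V n + V n. *)
pose fix P n : set X := if n is m.+1 then
  (next (m, P m)).1.1 `&` (next (m, P m)).1.2 else setT.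
have P0 n : nbhs (0 : X) (P n).
  elim: n => [|n IH] /=; first exact: filterT.
  by have [[h _] [h' _] _ _ _] := nextP (n, P n) IH; exact: filterI.
exists (fun n => (next (n, P n)).1.1), (fun n => (next (n, P n)).1.2).
exists (fun n => (next (n, P n)).2) => n.
have [h1 h2 h3 h4 h5] := nextP (n, P n) (P0 n); split=> // x y Vx Vy.
have [_ [_ VVP] _ _ _] := nextP (n.+1, P n.+1) (P0 n.+1).
exact: VVP x y Vx Vy.
Qed.

(** F is the intersection of the sets G n.  An open set inside F would contain a
    translate of some V n, which G n forbids.  A compact C is moved into the
    G n one after the other; the later corrections keep it in G n because they
    do not exceed the room V' n, and keep it there in the limit because G n is
    closed. *)
Lemma compact_catcher (X : topologicalZmodType) (S : nat -> seq X)
    (B : nat -> set X) :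
  seq_complete X -> universal_nets S -> nbhs0_base B ->
  (forall V, nbhs (0 : X) V -> ~ totally_bounded V) ->
  exists F : set X, [/\ closed F, nowhere_dense F &
    forall C : set X, compact C -> exists x, forall c, C c -> F (c + x)].
Proof.
move=> cX netS baseB ntb; have [_ Bsub] := baseB.
have [V [V' [G VG]]] := catching_set_sequence netS baseB ntb.
have VB n : V n `<=` B n by have [[_ ?] _ _ _ _] := VG n.
have V00 n : V n 0 by have [[V0 _] _ _ _ _] := VG n; exact: nbhs_singleton.
have VV n x y : V n.+1 x -> V n.+1 y -> V n (x + y) /\ V' n (x + y).
  by have [_ + _ _ _] := VG n; apply.
have clG n : closed (G n) by have [] := VG n.
pose F := \bigcap_n G n.
have clF : closed F by apply: closed_bigI => n _.
exists F; split=> //.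
  rewrite /nowhere_dense -(closure_id F).1 // -subset0 => x /nbhs_translate.
  move=> /Bsub[n BnF]; have [_ _ _ _ /(_ x)] := VG n; apply => v /VB/BnF.
  by move=> /(_ n I).
move=> C cC.
have catch : forall z : nat * X, exists g : X, V z.1 g /\
    forall c v, C c -> V' z.1 v -> G z.1 (c + (z.2 + g) + v).
  move=> [n x] /=; have [_ _ _ + _] := VG n.
  move=> /(_ [set c + x | c in C])[|g Vg hg].
    apply: continuous_compact => //; apply: continuous_subspaceT => c.
    exact: addr_continuous.
  by exists g; split=> // c v Cc V'v; rewrite addrA; apply: hg => //; exists c.
have {catch}[gam gamP] := choice catch.
pose fix x n : X := if n is m.+1 then x m + gam (m, x m) else 0.
have gamV n : V n (gam (n, x n)) by have [] := gamP (n, x n).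
(* A sum of one term from each of V n, V n.+1, ... is a sum of two terms of
   V n, since V n.+1 + V n.+1 is included in V n. *)
have tail p : forall n, exists a b,
    [/\ V n a, V n b & x (n + p)%N - x n = a + b].
  elim: p => [|p IH] n; first by exists 0, 0; rewrite addn0 subrr addr0.
  have [a [b [Va Vb ab]]] := IH n.+1.
  exists (gam (n, x n)), (a + b); split=> //.
    by have [] := VV _ _ _ Va Vb.
  by rewrite -ab addSnnS /= opprD addrCA [- x n - _]addrC !addrA addrK addrC.
have tail1 n p :
    V n (x (n.+1 + p)%N - x n.+1) /\ V' n (x (n.+1 + p)%N - x n.+1).
  by have [a [b [Va Vb ->]]] := tail p n.+1; exact: VV.
have [l xl] : exists l : X, x n @[n --> \oo] --> l.
  apply: cX => U /nbhs0_split[W [W0 WN _ WWU]]; have [n BW] := Bsub _ W0.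
  exists n.+1 => i j ni nj.
  have Wt k : (n < k)%N -> W (x k - x n.+1).
    by move=> /subnKC <-; apply/BW/VB; have [] := tail1 n (k - n.+1)%N.
  by rewrite -(subrK (x n.+1) (x i)) -addrA; apply: WWU;
     [exact: Wt | rewrite -opprB; apply/WN/Wt].
exists l => c Cc n _; apply: clG => O /nbhs_translate O0.
have /xl[N _ hN] : nbhs l [set y | O (c + y)].
  by apply/nbhs_translate; apply: filterS O0 => y /=; rewrite addrA.
exists (c + x (n.+1 + N)%N); split; last by apply: hN; rewrite /= leq_addl.
have [_ /(_ _ _ Cc (tail1 n N).2)] := gamP (n, x n).
by rewrite -addrA subrKC.
Qed.

(** * The Baire category theorem for compact regular spaces *)

(** Nonempty open sets O n are chosen with closure (O n.+1) included in O n and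
    disjoint from N n; a cluster point of this decreasing sequence lies in no
    N n. *)
Lemma compact_nonmeager (T : topologicalType) :
  [set: T] !=set0 -> compact [set: T] -> regular_space T ->
  ~ meager [set: T].
Proof.
move=> T0 cT regT [N ndN TN].
pose good (U : set T) := open U /\ U !=set0.
have next : forall z : nat * set T, exists W : set T, good z.2 ->
    good W /\ closure W `<=` z.2 `\` closure (N z.1).
  move=> [n U] /=; have [[oU [u Uu]]|ngU] := pselect (good U); last first.
    by exists set0.
  have [y [Uy nNy]] : U `\` closure (N n) !=set0.
    apply/set0P/eqP => UN0; suff : (closure (N n))° u by rewrite ndN.
    apply: (@filterS _ (nbhs u) _ U); last exact: open_nbhs_nbhs.
    by rewrite -setD_eq0.
  have : nbhs y (U `\` closure (N n)).
    apply: open_nbhs_nbhs; split=> //; rewrite setDE.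
    by apply: openI => //; apply/closed_openC/closed_closure.
  move=> /regT[W yW WU]; exists W° => _; split.
    split; first exact: open_interior.
    by exists y; exact: nbhs_singleton (nbhs_interior yW).
  by apply: subset_trans WU; apply: closureS; exact: interior_subset.
have {next}[f fP] := choice next.
pose fix O n : set T := if n is m.+1 then f (m, O m) else setT.
have gO n : good (O n).
  elim: n => [|n IH]; first by split; [exact: openT|].
  by have [] := fP (n, O n) IH.
have clO n : closure (O n.+1) `<=` O n `\` closure (N n).
  by have [] := fP (n, O n) (gO n).
have decr m n : (m <= n)%N -> O n `<=` O m.
  move=> /subnKC <-; elim: (n - m)%N => [|p IH]; first by rewrite addn0.
  by rewrite addnS => x /subset_closure/clO[/IH].
have FF : Filter (filter_from setT O).
  apply: filter_from_filter; first by exists 0%N.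
  move=> i j _ _; exists (maxn i j) => // x Ox.
  by split; [apply: (decr i) Ox; rewrite leq_maxl
            | apply: (decr j) Ox; rewrite leq_maxr].
have PF : ProperFilter (filter_from setT O).
  by apply: filter_from_proper => n _; have [] := gO n.
have [|p [_ clp]] := cT _ PF; first exact: filterT.
have : [set: T] p by []. rewrite TN => -[n _ Np].
have /clO[_] : closure (O n.+1) p by move=> U pU; apply: clp => //; exists n.+1.
by apply; exact: subset_closure.
Qed.

(** * A closed meager set that is not Haar meager *)

Theorem mainTheorem3 (R : realType) (X : topologicalZmodType)
    (polishX : polish R X) (not_lcX : ~ locally_compact [set: X]) :
  exists F : set X, [/\ closed F, meager F & ~ haar_meager R F].
Proof.
have [sepX metX] := polishX.
have cX := completely_metrizable_seq_complete metX.
have [B baseB] := completely_metrizable_nbhs0_base metX.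
have [S netS] := separable_universal_nets sepX.
have ntb := not_locally_compact_not_totally_bounded cX baseB not_lcX.
have [F [clF ndF catch]] := compact_catcher cX netS baseB ntb.
exists F; split=> //.
  by exists (fun=> F) => //; rewrite bigcup_const //; exists 0%N.
move=> [A [_ FA [K [f [K0 cK cf mK]]]]].
have [|x fx] := catch (f @` [set: K]).
  by apply: continuous_compact => //; exact: continuous_subspaceT.
apply: (compact_nonmeager K0 cK (@uniform_regular K)).
rewrite (_ : [set: K] = f @^-1` [set b + - x | b in A]) //.
apply/seteqP; split=> // k _; exists (f k + x); last by rewrite addrK.
by apply: FA; apply: fx; exists k.
Qed.
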